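(* Let $m\ge0$ be an integer, let $\alpha>m-1$ be real, and let $n\ge m$ be an integer. Then the type II exceptional Laguerre polynomial $L^{\mathrm{II}(\alpha)}_{m,n}$ has no zeros in $(-\infty,0)$ if $m$ is even, and exactly one zero in $(-\infty,0)$ if $m$ is odd.
   Context: For real $\alpha$ and integer $n\ge 0$, $L^{(\alpha)}_n(z)=\sum_{k=0}^n \binom{n+\alpha}{n-k}\frac{(-z)^k}{k!}$ is the classical Laguerre polynomial (generalized binomial coefficients), and $L^{(\alpha)}_{-1}:=0$. Put $\eta_{\alpha,m}(z)=L^{(-\alpha)}_m(z)$ and $A^{\mathrm{II}}_{\alpha,m}[y]=z\,\eta_{\alpha,m}\,y'+(\alpha-m)\,\eta_{\alpha+1,m}\,y$. For $n\ge m\ge0$ and $j=n-m$, the degree $n$ type II exceptional Laguerre polynomial is $L^{\mathrm{II}(\alpha)}_{m,n}=-A^{\mathrm{II}}_{\alpha+1,m}\big[L^{(\alpha+1)}_{j}\big]$, i.e. $L^{\mathrm{II}(\alpha)}_{m,n}(z)=z\,L^{(-\alpha-1)}_m(z)L^{(\alpha+2)}_{j-1}(z)+(m-\alpha-1)L^{(-\alpha-2)}_m(z)L^{(\alpha+1)}_j(z)$. *)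

(* Defs.v *)
From mathcomp Require Import all_boot all_order all_algebra.
From mathcomp Require Import reals.

Set Implicit Arguments.
Unset Strict Implicit.
Unset Printing Implicit Defensive.

Import Order.TTheory GRing.Theory Num.Theory.
Local Open Scope ring_scope.

(* Generalized binomial coefficient: x (x - 1) ... (x - k + 1) / k! *)
Definition gbinomial (R : realType) (x : R) (k : nat) : R :=
  (\prod_(i < k) (x - i%:R)) / k`!%:R.

Definition laguerre (R : realType) (alpha : R) (n : nat) : {poly R} :=
  \sum_(k < n.+1) (gbinomial (n%:R + alpha) (n - k) / k`!%:R) *: (- 'X) ^+ k.

Definition eta (R : realType) (alpha : R) (m : nat) : {poly R} :=
  laguerre (- alpha) m.

Definition AII (R : realType) (alpha : R) (m : nat) (y : {poly R}) : {poly R} :=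
  'X * eta alpha m * y^`() + (alpha - m%:R) *: (eta (alpha + 1) m * y).

(* Meaningful for m <= n only, since n - m is truncated. *)
Definition xlaguerreII (R : realType) (alpha : R) (m n : nat) : {poly R} :=
  - AII (alpha + 1) m (laguerre (alpha + 1) (n - m)).

Lemma deriv_laguerre (R : realType) (alpha : R) (n : nat) :
  (laguerre alpha n)^`() = if n is k.+1 then - laguerre (alpha + 1) k else 0.
Proof.
case: n => [|n]; first by rewrite /laguerre big_ord1 expr0 derivZ derivC scaler0.
rewrite /laguerre raddf_sum big_ord_recl /= expr0 derivZ derivC scaler0 add0r.
rewrite -sumrN; apply: eq_bigr => i _.
rewrite /bump /= add1n subSS derivZ deriv_exp derivN derivX /= mulN1r mulNrn.
rewrite scalerN -scaler_nat scalerA factS natrM invfM; congr (- (_ *: _)).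
rewrite -natr1 -addrA [1 + alpha]addrC -!mulrA; congr (_ * _).
by congr (_ * _); rewrite mulrCA mulVf ?mulr1 // pnatr_eq0.
Qed.

(* The closed form, with the convention that the polynomial of degree -1 is 0. *)
Lemma xlaguerreIIE (R : realType) (alpha : R) (m n : nat) :
  xlaguerreII alpha m n =
    'X * laguerre (- alpha - 1) m *
      (if (n - m)%N is k.+1 then laguerre (alpha + 2) k else 0)
    + (m%:R - alpha - 1) *:
      (laguerre (- alpha - 2) m * laguerre (alpha + 1) (n - m)).
Proof.
have D2 : alpha + 1 + 1 = alpha + 2 by rewrite -addrA.
have Dm : - (alpha + 1 - m%:R) = m%:R - alpha - 1.
  by rewrite opprB opprD addrA.
rewrite /xlaguerreII /AII /eta deriv_laguerre D2 opprD -scaleNr Dm.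
rewrite [- (alpha + 1)]opprD [- (alpha + 2)]opprD.
by congr (_ + _); case: (n - m)%N => [|k]; rewrite ?mulr0 ?oppr0 // mulrN opprK.
Qed.

(* Main.v *)
(* Reflect by z = - x, and put b = alpha + 1, E(x) = L_m^(-b)(- x),
   F(x) = L_(n-m)^(b)(- x), G(x) = - L^II_(m,n)(- x).  Then
   G = x (E F' - E' F) + b E F is, up to the factor x^(b+1), the Wronskian of
   x^(-b) E and F, two eigenfunctions of the same second-order operator; hence
   G' + G = (n + b - 2 m) E F, that is, (e^x G)' = (n + b - 2 m) e^x E F.  On
   x >= 0, F is positive, while E is positive for m even and changes sign once,
   from negative to positive, for m odd.  This is inherited by e^x G, since
   G(0) = b E(0) F(0) has the sign of E(0).  The signs of E = E_m follow by
   induction on m with b - m fixed, since then E_m' = E_(m-1). *)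

Require Import Defs.
From mathcomp Require Import all_boot all_order all_algebra.
From mathcomp Require Import reals.
From mathcomp Require Import classical_sets functions topology normedtype.
From mathcomp Require Import sequences derive realfun exp polyrcf ring lra.

Import Order.TTheory GRing.Theory Num.Theory.
Import numFieldNormedType.Exports.
Local Open Scope ring_scope.

(** * Passing signs from p' + s p to p *)

Lemma expR_mul_poly_lt (R : realType) (s : R) (p : {poly R}) (a b : R) :
  a < b -> (forall x, a < x < b -> 0 < (p^`() + s *: p).[x]) ->
  expR (s * a) * p.[a] < expR (s * b) * p.[b].
Proof.
move=> ab dp_gt0.
(* The mean value theorem is applied to e^(s x) p, whose derivative is e^(s x) (p' + s p). Later
   uses take s = 0 or s = 1. *)
pose f : R -> R := (expR \o ( *%R s)) * horner p.
have df (x : R) : is_derive x 1 f (expR (s * x) * (p^`() + s *: p).[x]).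
  have is_ds : is_derive x 1 ( *%R s) s.
    apply: is_derive_eq (is_deriveZ s (is_derive_id x 1)) _.
    by rewrite /GRing.scale /= mulr1.
  have is_de := is_derive1_comp (is_derive_expR (s * x)) is_ds.
  apply: is_derive_eq (is_deriveM is_de (is_derive_poly p x)) _.
  by rewrite !hornerE /GRing.scale /=; ring.
have cf : {within `[a, b]%classic, continuous f}%classic.
  by apply: derivable_within_continuous => x _; case: (df x).
have [c cab fab] := MVT ab (fun x _ => df x) cf.
rewrite -subr_gt0 [ltRHS]fab.
by rewrite mulr_gt0 ?subr_gt0 // mulr_gt0 ?expR_gt0 // dp_gt0 // -in_itv.
Qed.

(** The value at [x0] is left free, and for [x0 = 0] the negative range is empty, so positivity on x
    > 0 also qualifies. *)
Definition sign_change_at {R : realType} (p : {poly R}) (x0 : R) :=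
  [/\ 0 <= x0, forall x, 0 <= x < x0 -> p.[x] < 0
    & forall x, x0 < x -> 0 < p.[x]].

(** On [0, x1] the function e^(s x) p decreases from a negative value; past [x1] it increases
    strictly. The leading coefficient makes p eventually positive, so p vanishes exactly once,
    beyond [x1]. *)
Lemma sign_change_primitive (R : realType) (s : R) (p : {poly R}) (x1 : R) :
  sign_change_at (p^`() + s *: p) x1 -> p.[0] < 0 -> 0 < lead_coef p ->
  exists2 x0, root p x0 & sign_change_at p x0.
Proof.
case=> x1_ge0 q_lt0 q_gt0 p0_lt0 lc_p.
have p_lt0 x : 0 <= x <= x1 -> p.[x] < 0.
  case/andP; rewrite le_eqVlt => /predU1P[<- //|x_gt0 xx1].
  have /(_ _)/wrap[] := @expR_mul_poly_lt R s (- p) 0 x x_gt0.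
    move=> y /andP[y_gt0 yx]; rewrite derivN scalerN -opprD hornerN oppr_gt0.
    by apply: q_lt0; rewrite ltW //= (lt_le_trans yx).
  rewrite !hornerN !mulrN ltrN2 mulr0 expR0 mul1r => /lt_trans/(_ p0_lt0).
  by rewrite pmulr_rlt0 ?expR_gt0.
have mono x y : x1 <= x -> x < y -> expR (s * x) * p.[x] < expR (s * y) * p.[y].
  move=> x1x xy; apply: expR_mul_poly_lt => // z /andP[xz _].
  by apply: q_gt0; apply: le_lt_trans xz.
have [n p_ge_lc] := poly_pinfty_gt_lc lc_p.
have [] := @poly_ivtoo R p x1 (Num.max n x1).
- by rewrite le_max lexx orbT.
- rewrite nmulr_rlt0; last by rewrite p_lt0 // x1_ge0 lexx.
  by apply: lt_le_trans lc_p (p_ge_lc _ _); rewrite le_max lexx.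
move=> x0 /[!in_itv] /andP[x1x0 _] px0; exists x0 => //.
split=> [|x /andP[x_ge0 xx0]|x x0x]; first exact: ltW (le_lt_trans x1_ge0 x1x0).
- case: (leP x x1) => [xx1|x1x]; first by rewrite p_lt0 ?x_ge0.
  have := mono x x0 (ltW x1x) xx0.
  by rewrite (rootP px0) mulr0 pmulr_rlt0 ?expR_gt0.
- have := mono x0 x (ltW x1x0) x0x.
  by rewrite (rootP px0) mulr0 pmulr_rgt0 ?expR_gt0.
Qed.

(** * Reflected Laguerre polynomials *)

Definition rlaguerre {R : realType} (alpha : R) (n : nat) : {poly R} :=
  laguerre alpha n \Po (- 'X).

Section ReflectedLaguerre.
Variable R : realType.
Implicit Types (alpha x : R) (n : nat).

Lemma gbinomialS x k :
  k.+1%:R * gbinomial x k.+1 = (x - k%:R) * gbinomial x k.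
Proof.
rewrite /gbinomial big_ord_recr factS natrM /= invfM.
by field; rewrite nat1r !pnatr_eq0 -lt0n fact_gt0.
Qed.

(** Both sides are x (x - 1) ... (x - k) / k!. *)
Lemma gbinomial_pred x k :
  x * gbinomial (x - 1) k = (x - k%:R) * gbinomial x k.
Proof.
rewrite /gbinomial !mulrA; congr (_ / _).
have -> : (x - k%:R) * \prod_(i < k) (x - i%:R) = \prod_(i < k.+1) (x - i%:R).
  by rewrite big_ord_recr mulrC.
rewrite big_ord_recl subr0.
congr (_ * _); apply: eq_bigr => i _; rewrite lift0 -natr1; ring.
Qed.

Lemma gbinomial_gt0 x k : k%:R < x + 1 -> 0 < gbinomial x k.
Proof.
move=> kx; rewrite divr_gt0 ?ltr0n ?fact_gt0 // prodr_gt0 // => i _.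
by rewrite subr_gt0 -(ltrD2r 1) natr1 (le_lt_trans _ kx) ?ler_nat.
Qed.

Lemma gbinomial_neg_sign x k : x < 0 -> 0 < (-1) ^+ k * gbinomial x k.
Proof.
move=> x_lt0; rewrite mulrA divr_gt0 ?ltr0n ?fact_gt0 //.
elim: k => [|k IHk]; first by rewrite big_ord0 mulr1.
rewrite big_ord_recr exprSr /= mulrACA mulN1r opprB.
by rewrite mulr_gt0 // subr_gt0 (lt_le_trans x_lt0).
Qed.

Lemma rlaguerreE alpha n :
  rlaguerre alpha n =
  \poly_(k < n.+1) (gbinomial (n%:R + alpha) (n - k) / k`!%:R).
Proof.
rewrite /rlaguerre /laguerre raddf_sum poly_def; apply: eq_bigr => i _ /=.
by rewrite linearZ /= rmorphXn /= rmorphN /= comp_polyX opprK.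
Qed.

Lemma coef_rlaguerre alpha n k :
  (rlaguerre alpha n)`_k =
  if (k <= n)%N then gbinomial (n%:R + alpha) (n - k) / k`!%:R else 0.
Proof. by rewrite rlaguerreE coef_poly. Qed.

Lemma deriv_rlaguerre alpha n :
  (rlaguerre alpha n)^`() = if n is k.+1 then rlaguerre (alpha + 1) k else 0.
Proof.
rewrite /rlaguerre deriv_comp deriv_laguerre derivN derivX mulrN1.
by case: n => [|n]; rewrite ?comp_poly0 ?oppr0 // rmorphN opprK.
Qed.

(** Laguerre's equation after z = - x. Coefficientwise it is the two-term recurrence [e]. *)
Lemma rlaguerre_ode alpha n :
  'X * (rlaguerre alpha n)^`()^`()
    + ((alpha + 1)%:P + 'X) * (rlaguerre alpha n)^`()
  = n%:R *: rlaguerre alpha n.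
Proof.
apply/polyP => k; rewrite mulrDl !(coefD, coefXM, coefCM, coefZ).
rewrite !coef_deriv.
have e : (k.+1%:R * (k.+1%:R + alpha)) * (rlaguerre alpha n)`_k.+1 =
   (n%:R - k%:R) * (rlaguerre alpha n)`_k.
  rewrite !coef_rlaguerre; case: ltngtP => [kn|kn|->];
    last by rewrite subrr mulr0 mul0r.
    rewrite -(subnSK kn) factS natrM.
    have := gbinomialS (n%:R + alpha) (n - k.+1).
    rewrite -natr1 natrB //.
    set h := gbinomial _ _; set g := gbinomial _ _ => gh.
    have -> : (n%:R - k%:R) * (h / k`!%:R) = ((n%:R - k.+1%:R + 1) * h) / k`!%:R.
      by ring.
    by rewrite gh; field; rewrite nat1r !pnatr_eq0 -lt0n fact_gt0.
  by rewrite !mulr0.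
have -> : n%:R * (rlaguerre alpha n)`_k =
    k.+1%:R * (k.+1%:R + alpha) * (rlaguerre alpha n)`_k.+1
    + k%:R * (rlaguerre alpha n)`_k by rewrite e; ring.
by case: k {e} => [|k] /=; ring.
Qed.

(** Coefficientwise this is [gbinomial_pred]. It serves to express L_m^(-b-1)(- x) through E and
    E'. *)
Lemma rlaguerre_lower alpha n :
  'X * (rlaguerre alpha n)^`() + alpha *: rlaguerre alpha n
  = (n%:R + alpha) *: rlaguerre (alpha - 1) n.
Proof.
apply/polyP => k; rewrite !(coefD, coefXM, coefZ) coef_deriv.
have e : (k%:R + alpha) * (rlaguerre alpha n)`_k =
    (n%:R + alpha) * (rlaguerre (alpha - 1) n)`_k.
  rewrite !coef_rlaguerre; case: leqP => [kn|_]; last by rewrite !mulr0.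
  rewrite addrA 2!mulrA gbinomial_pred natrB //; congr (_ * _ / _); ring.
by rewrite -e; case: k {e} => [|k] /=; ring.
Qed.

Lemma rlaguerre_at0 alpha n :
  (rlaguerre alpha n).[0] = gbinomial (n%:R + alpha) n.
Proof. by rewrite horner_coef0 coef_rlaguerre subn0 divr1. Qed.

Lemma lead_coef_rlaguerre alpha n : lead_coef (rlaguerre alpha n) = n`!%:R^-1.
Proof.
have n_fact_neq0 : n`!%:R^-1 != 0 :> R.
  by rewrite invr_eq0 pnatr_eq0 -lt0n fact_gt0.
by rewrite rlaguerreE lead_coef_poly //= subnn /gbinomial big_ord0 divr1 mul1r.
Qed.

(** For alpha > -1 every coefficient is positive. *)
Lemma rlaguerre_gt0 alpha n x :
  -1 < alpha -> 0 <= x -> 0 < (rlaguerre alpha n).[x].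
Proof.
move=> alpha_gtN1 x_ge0; rewrite rlaguerreE horner_poly.
have term_gt0 k : (k <= n)%N -> 0 < gbinomial (n%:R + alpha) (n - k) / k`!%:R.
  move=> kn; rewrite divr_gt0 ?ltr0n ?fact_gt0 // gbinomial_gt0 //.
  rewrite natrB // -addrA; have : 0 <= k%:R :> R by []. lra.
rewrite big_ord_recl expr0 mulr1 ltr_pwDl ?term_gt0 // sumr_ge0 // => i _.
by rewrite mulr_ge0 ?exprn_ge0 // ltW ?term_gt0 // -ltnS ltn_ord.
Qed.

End ReflectedLaguerre.

(** * Signs of E on x >= 0 *)

Lemma rlaguerre_parity (R : realType) (c : R) (m : nat) : 0 < c ->
  if odd m then exists x0, sign_change_at (rlaguerre (- (m%:R + c)) m) x0
  else forall x, 0 <= x -> 0 < (rlaguerre (- (m%:R + c)) m).[x].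
Proof.
move=> c_gt0; pose e m : {poly R} := rlaguerre (- (m%:R + c)) m.
have de k : (e k.+1)^`() = e k.
  rewrite /e deriv_rlaguerre; congr rlaguerre; rewrite -natr1; ring.
have e0 k : 0 < (-1) ^+ k * (e k).[0].
  rewrite rlaguerre_at0 gbinomial_neg_sign //; lra.
(* The odd case is strengthened: [e m] vanishes at [x0] with positive slope, which feeds the
   second-order equation of [e m.+1] at that point. *)
suff : if odd m then exists2 x0, sign_change_at (e m) x0
                               & root (e m) x0 && (0 < (e m)^`().[x0])
       else forall x, 0 <= x -> 0 < (e m).[x].
  by case: ifP => // _ [x0 ?]; exists x0.
elim: m => [|m IHm] /=.
  by move=> x x_ge0; rewrite /e rlaguerreE horner_poly big_ord1 /gbinomial
    big_ord0 !divr1 mulr1.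
move: (e0 m.+1) (e0 m); rewrite -signr_odd -[_ ^+ m]signr_odd /=.
case: ifP IHm => /= [om [x0 [x0_ge0 e_lt0 e_gt0] /andP[/rootP ex0 dex0]]|em e_gt0].
  rewrite expr0 mul1r expr1 mulN1r oppr_gt0 => _ em0.
  have x0_gt0 : 0 < x0.
    rewrite lt_neqAle x0_ge0 andbT.
    by apply: contraTneq em0 => x0E; rewrite [X in _.[X]]x0E ex0 ltxx.
  (* At the critical point x0 of e m.+1, the Laguerre equation reads
     x0 * e''(x0) = m.+1 * e(x0). *)
  have min_gt0 : 0 < (e m.+1).[x0].
    have /(congr1 (horner^~ x0)) := rlaguerre_ode R (- (m.+1%:R + c)) m.+1.
    rewrite -/(e m.+1) de !hornerE ex0 mulr0 addr0 => ode.
    by rewrite -(pmulr_rgt0 _ (ltr0Sn R m)) -ode mulr_gt0.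
  (* [e m.+1] falls before [x0] and rises after it, so its positive value there is the minimum on x
     >= 0. *)
  move=> x x_ge0; case: (ltgtP x x0) => [xx0|x0x|-> //].
    have /(_ _)/wrap[] := @expR_mul_poly_lt R 0 (- e m.+1) x x0 xx0.
      move=> y /andP[xy yx0]; rewrite scale0r addr0 derivN de hornerN oppr_gt0.
      by rewrite e_lt0 // yx0 (le_trans x_ge0) ?ltW.
    by rewrite !mul0r expR0 !mul1r !hornerN ltrN2; apply: lt_trans.
  have /(_ _)/wrap[] := @expR_mul_poly_lt R 0 (e m.+1) x0 x x0x.
    by move=> y /andP[x0y _]; rewrite scale0r addr0 de e_gt0.
  by rewrite !mul0r expR0 !mul1r; apply: lt_trans.
rewrite expr1 mulN1r oppr_gt0 => em0 _.
(* For m even, the derivative [e m] is positive on x >= 0, so its sign change is placed at 0. *)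
have [||| x0 ex0 x0P] := @sign_change_primitive R 0 (e m.+1) 0; last first.
- by exists x0 => //; rewrite ex0 de e_gt0 //; case: x0P.
- by rewrite lead_coef_rlaguerre invr_gt0 ltr0n fact_gt0.
- by [].
rewrite scale0r addr0 de; split=> // x; last by move/ltW/e_gt0.
by case/andP=> /le_lt_trans h /h; rewrite ltxx.
Qed.

(** * Wronskian form of G and its first-order equation *)

Lemma xlaguerreII_wronskian (R : realType) (alpha : R) (m n : nat) :
  let E := rlaguerre (- (alpha + 1)) m in
  let F := rlaguerre (alpha + 1) (n - m) in
  - (xlaguerreII alpha m n \Po - 'X) =
    'X * (E * F^`() - E^`() * F) + (alpha + 1) *: (E * F).
Proof.
move=> E F.
have lower : (m%:R - alpha - 1) *: rlaguerre (- alpha - 2) m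
    = 'X * E^`() - (alpha + 1) *: E.
  have := rlaguerre_lower R (- (alpha + 1)) m.
  rewrite -/E scaleNr => ->; rewrite opprD addrA; congr (_ *: rlaguerre _ _); ring.
rewrite xlaguerreIIE comp_polyD comp_polyZ !comp_polyM comp_polyX.
rewrite -!/(rlaguerre _ _) -/F scalerAl lower.
have -> : rlaguerre (- alpha - 1) m = E by rewrite /E opprD.
(* For n = m the default 0 is the derivative of the constant F. *)
have -> : (if (n - m)%N is k.+1 then laguerre (alpha + 2) k else 0) \Po - 'X
    = F^`().
  rewrite /F deriv_rlaguerre; case: (n - m)%N => [|k]; first by rewrite comp_poly0.
  by congr rlaguerre; ring.
rewrite -!mul_polyC; ring.
Qed.

Lemma deriv_xlaguerreII_reflected (R : realType) (alpha : R) (m n : nat) :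
  (m <= n)%N ->
  let G := - (xlaguerreII alpha m n \Po - 'X) in
  G^`() + G = (n%:R + alpha + 1 - m%:R *+ 2) *:
    (rlaguerre (- (alpha + 1)) m * rlaguerre (alpha + 1) (n - m)).
Proof.
move=> mn; cbv zeta; rewrite xlaguerreII_wronskian.
have := rlaguerre_ode R (- (alpha + 1)) m.
have := rlaguerre_ode R (alpha + 1) (n - m).
set E := rlaguerre _ m; set F := rlaguerre _ (n - m).
rewrite natrB //.
rewrite !(derivD, derivN, derivM, derivX, derivZ) -!mul_polyC.
rewrite !(polyCD, polyCN, polyCMn).
set a := alpha%:P; set N := 1%:P *+ n; set M := 1%:P *+ m.
move=> odeF odeE.
(* Splitting n + b - 2 m as (n - m) - m + b matches the equations of F and E; the terms x E' F'
   cancel. *)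
have -> : (N + a + 1%:P - (M + M)) * (E * F) =
  E * ((N - M) * F) - F * (M * E) + (a + 1%:P) * (E * F) by ring.
rewrite -odeF -odeE; ring.
Qed.

(** * Counting the negative zeros *)

Theorem proposition4p4 (R : realType) (m n : nat) (alpha : R)
    (halpha : m%:R - 1 < alpha) (hmn : (m <= n)%N) :
  (~~ odd m -> forall x : R, x < 0 -> ~~ root (xlaguerreII alpha m n) x) /\
  (odd m -> exists! x : R, x < 0 /\ root (xlaguerreII alpha m n) x).
Proof.
set P := xlaguerreII alpha m n.
pose G := - (P \Po - 'X).
pose E := rlaguerre (- (alpha + 1)) m.
pose F := rlaguerre (alpha + 1) (n - m).
have GE x : G.[x] = - P.[- x] by rewrite hornerN horner_comp !hornerE.
have rootP_G x : root P x = root G (- x) by rewrite !rootE GE opprK oppr_eq0.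
have m_ge0 : 0 <= m%:R :> R by [].
have nm_ge0 : m%:R <= n%:R :> R by rewrite ler_nat.
pose k := n%:R + alpha + 1 - m%:R *+ 2.
have k_gt0 : 0 < k by rewrite /k mulr2n; lra.
have dG : G^`() + G = k *: (E * F) by apply: deriv_xlaguerreII_reflected.
have F_gt0 x : 0 <= x -> 0 < F.[x] by apply: rlaguerre_gt0; lra.
have G0E : G.[0] = (alpha + 1) * (E.[0] * F.[0]).
  by rewrite /G /P xlaguerreII_wronskian !hornerE.
have := @rlaguerre_parity R (alpha + 1 - m%:R) m.
rewrite subrKC -/E => /(_ _)/wrap[]; first lra.
(* This fixes the sign of E(0), which a sign change located at 0 would leave open. *)
have := @gbinomial_neg_sign R (m%:R + - (alpha + 1)) m.
rewrite -rlaguerre_at0 -/E -signr_odd => /(_ _)/wrap[]; first lra.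
case: ifP => om /= E0 E_sign; split=> // _; last first.
  move=> x x_lt0; rewrite rootP_G; apply: lt0r_neq0.
  have Nx_gt0 : 0 < - x by rewrite oppr_gt0.
  (* For m even, e^x G increases from the positive value G(0). *)
  have /(_ _)/wrap[] := @expR_mul_poly_lt R 1 G 0 (- x) Nx_gt0.
    move=> y /andP[/ltW y_ge0 _].
    by rewrite scale1r dG !hornerE !mulr_gt0 ?E_sign ?F_gt0.
  rewrite mulr0 expR0 !mul1r => lt_G.
  rewrite -(@pmulr_rgt0 _ (expR (- x))) ?expR_gt0 //; apply: lt_trans lt_G.
  rewrite G0E !mulr_gt0 ?F_gt0 ?E_sign //; lra.
have [x1 [x1_ge0 E_lt0 E_gt0]] := E_sign.
have G0_lt0 : G.[0] < 0.
  rewrite G0E pmulr_rlt0; last lra.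
  by move: E0; rewrite pmulr_llt0 ?F_gt0 // expr1 mulN1r oppr_gt0.
have G_neq0 : G != 0 by apply: contraTneq G0_lt0 => ->; rewrite horner0 ltxx.
have lcG : 0 < lead_coef G.
  (* G' has lower degree, so G has the leading coefficient of G' + G = k E F. *)
  rewrite -(lead_coefDr (lt_size_deriv G_neq0)) dG lead_coefZ lead_coefM.
  by rewrite !lead_coef_rlaguerre !mulr_gt0 // invr_gt0 ltr0n fact_gt0.
have dG_sign : sign_change_at (G^`() + 1 *: G) x1.
  rewrite scale1r dG; split=> // x.
    move=> x_lt; rewrite hornerZ hornerM pmulr_rlt0 // pmulr_llt0 ?E_lt0 //.
    by case/andP: x_lt => /F_gt0.
  move=> x1x; rewrite !hornerE !mulr_gt0 ?E_gt0 ?F_gt0 //.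
  exact: ltW (le_lt_trans x1_ge0 x1x).
have [x0 Gx0 [x0_ge0 G_lt0 G_gt0]] :=
  sign_change_primitive R 1 G x1 dG_sign G0_lt0 lcG.
have x0_gt0 : 0 < x0.
  rewrite lt_neqAle x0_ge0 andbT; apply: contraTneq G0_lt0 => x0E.
  by rewrite [X in _.[X]]x0E (rootP Gx0) ltxx.
exists (- x0); split; first by rewrite oppr_lt0 rootP_G opprK.
move=> x [x_lt0]; rewrite rootP_G => /rootP Gx.
(* Any other root would fall where G is strictly negative or strictly positive. *)
apply: oppr_inj; rewrite opprK; case: (ltgtP x0 (- x)) => // [/G_gt0|xx0].
  by rewrite Gx ltxx.
have := G_lt0 (- x); rewrite oppr_ge0 (ltW x_lt0) xx0 Gx ltxx => /(_ isT).
by [].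
Qed.
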